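(* Let $\{P_n\}_{n\ge 0}$ be the Catalan-Larcombe-French sequence, defined by $P_0=1$, $P_1=8$ and, for $n\ge 2$, $$n^2 P_n = 8(3n^2-3n+1)P_{n-1} - 128(n-1)^2 P_{n-2}.$$ Then $\{P_n\}_{n\ge 0}$ is ratio log-concave, that is, for all integers $n\ge 2$, $$\left(\frac{P_n}{P_{n-1}}\right)^2 \ge \frac{P_{n-1}}{P_{n-2}}\cdot\frac{P_{n+1}}{P_n}.$$
   Context: A real sequence $\{S_n\}$ is called ratio log-concave if the sequence of ratios $\{S_n/S_{n-1}\}$ is log-concave, i.e. $(S_n/S_{n-1})^2 \ge (S_{n-1}/S_{n-2})(S_{n+1}/S_n)$. *)

(* Defs.v *)
From mathcomp Require Import all_boot all_order all_algebra.

Set Implicit Arguments.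
Unset Strict Implicit.
Unset Printing Implicit Defensive.

Import Order.TTheory GRing.Theory Num.Theory.
Local Open Scope ring_scope.

(* The recurrence determines P uniquely, since n%:R ^+ 2 != 0 for n >= 2. *)
Definition Catalan_Larcombe_French (R : realFieldType) (P : nat -> R) : Prop :=
  [/\ P 0%N = 1, P 1%N = 8
    & forall n : nat, (2 <= n)%N ->
        n%:R ^+ 2 * P n =
          8 * (3 * n%:R ^+ 2 - 3 * n%:R + 1) * P (n - 1)%N
          - 128 * (n%:R - 1) ^+ 2 * P (n - 2)%N].

(* The ratios S n / S (n - 1) start at n = 1, so the first instance of
   log-concavity with all three ratios defined is n = 2. *)
Definition ratio_log_concave (R : realFieldType) (S : nat -> R) : Prop :=
  forall n : nat, (2 <= n)%N ->
    (S n / S (n - 1)%N) ^+ 2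
      >= (S (n - 1)%N / S (n - 2)%N) * (S (n + 1)%N / S n).

(* Main.v *)
(** Write [r n = P n / P (n - 1)].  The recurrence reads
    [r (n + 1) = A n - B n / r n], an increasing function of [r n], so the
    bounds [12 <= r n <= 16 (n - 1) / n] propagate by induction from [n = 5];
    the upper bound satisfies the recurrence up to an error of order [n ^- 3].
    Expressing [r (n - 1)] and [r (n + 1)] through [r n] turns ratio
    log-concavity into the nonnegativity of a quartic in [r n], which has
    nonnegative Bernstein coefficients on that interval.  The cases
    [n = 2, 3, 4] are checked on explicit values. *)

Require Import Defs.
From mathcomp Require Import all_boot all_order all_algebra.
From mathcomp Require Import ring lra.

Set Implicit Arguments.
Unset Strict Implicit.
Unset Printing Implicit Defensive.

Import Order.TTheory GRing.Theory Num.Theory.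
Local Open Scope ring_scope.

(* Purely syntactic matching: unifying [_ + _] with a numeral [k%:R] would
   unfold the numeral in unary. *)
Ltac positivity :=
  repeat match goal with
  | |- is_true (0 <= _ + _) => apply: addr_ge0
  | |- is_true (0 <= _ * _) => apply: mulr_ge0
  | |- is_true (0 <= _ ^+ _) => apply: exprn_ge0
  | |- is_true (0 <= _%:R) => exact: ler0n
  | |- _ => assumption
  end.

Section RealField.
Variable R : realFieldType.
Implicit Types (b c d m p q t : R) (P : nat -> R).

Lemma lower_bound_step t b c d : 2 <= t -> 0 <= b -> 12 * b <= c ->
  (t + 1) ^+ 2 * d = 8 * (3 * t ^+ 2 + 3 * t + 1) * c - 128 * t ^+ 2 * b ->
  12 * c <= d.
Proof.
move=> ht hb hc hd.
have ht1 : 0 < (t + 1) ^+ 2 by apply: exprn_gt0; lra.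
rewrite -(ler_pM2l ht1) hd -subr_ge0.
rewrite [leRHS](_ : _ =
  (12 * t ^+ 2 - 4) * (c - 12 * b) + (16 * t ^+ 2 - 48) * b); last by ring.
by apply: addr_ge0; apply: mulr_ge0; nra.
Qed.

Lemma upper_bound_step t b c d : 0 < t -> 0 <= b ->
  t * c <= 16 * (t - 1) * b ->
  (t + 1) ^+ 2 * d = 8 * (3 * t ^+ 2 + 3 * t + 1) * c - 128 * t ^+ 2 * b ->
  (t + 1) * d <= 16 * t * c.
Proof.
move=> ht hb hc hd.
have ht1 : 0 < t * (t + 1) by apply: mulr_gt0; lra.
rewrite -(ler_pM2l ht1).
rewrite [leLHS](_ : _ = t * ((t + 1) ^+ 2 * d)); last by ring.
rewrite hd -subr_ge0.
(* The term [128 * b] is the amount, of favourable sign, by which [16 * (t - 1) / t] fails to solve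
   the ratio recurrence. *)
rewrite [leRHS](_ : _ =
  8 * (t ^+ 2 + t + 1) * (16 * (t - 1) * b - t * c) + 128 * b); last by ring.
by apply: addr_ge0; [apply: mulr_ge0; nra | lra].
Qed.

(* With [m = t - 4], the right-hand side is [(t - 4) ^+ 4] times the quartic of
   [quartic_ge0]: its Bernstein expansion on the interval where both
   [p = 16 * (t - 1) * b - t * c] and [q = c - 12 * b] are nonnegative. *)
Lemma bernstein_form_ge0 m p q : 0 <= m -> 0 <= p -> 0 <= q ->
  0 <= (414 + 690 * m + 259 * m ^+ 2 + 32 * m ^+ 3 + m ^+ 4) * p ^+ 4
     + 2 * (3312 + 5331 * m + 3305 * m ^+ 2 + 934 * m ^+ 3 + 117 * m ^+ 4
            + 5 * m ^+ 5) * (p ^+ 3 * q)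
     + 24 * (m + 3) * (552 + 673 * m + 413 * m ^+ 2 + 130 * m ^+ 3
            + 19 * m ^+ 4 + m ^+ 5) * (p ^+ 2 * q ^+ 2)
     + 16 * (m + 3) ^+ 2 * (736 + 610 * m + 318 * m ^+ 2 + 105 * m ^+ 3
            + 17 * m ^+ 4 + m ^+ 5) * (p * q ^+ 3)
     + 64 * (m + 4) * (m + 3) ^+ 2 * (46 + 24 * m + 3 * m ^+ 2) * q ^+ 4.
Proof.
by move=> hm hp hq; positivity.
Qed.

Lemma quartic_ge0 t b c : 5 <= t -> 0 < b -> 12 * b <= c ->
  t * c <= 16 * (t - 1) * b ->
  0 <= c ^+ 3 * (8 * (3 * t ^+ 2 - 3 * t + 1) * b - t ^+ 2 * c) * (t + 1) ^+ 2
     - 128 * (t - 1) ^+ 2 * b ^+ 3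
         * (8 * (3 * t ^+ 2 + 3 * t + 1) * c - 128 * t ^+ 2 * b).
Proof.
move=> ht hb hcl hcu.
(* Since [4 * (t - 4) * b = p + t * q] and [(t - 4) * c = 3 * p + 4 * (t - 1) * q], this factor
   turns a quartic form in [b], [c] into one in [p], [q]. *)
have hD : 0 < (t - 4) ^+ 4 by apply: exprn_gt0; lra.
have hm : 0 <= t - 4 by lra.
have hp : 0 <= 16 * (t - 1) * b - t * c by lra.
have hq : 0 <= c - 12 * b by lra.
rewrite -(pmulr_rge0 _ hD).
have := bernstein_form_ge0 hm hp hq.
by congr (0 <= _); ring.
Qed.

Lemma ratio_log_concave_of_bounds t a b c d : 5 <= t ->
  0 < a -> 0 < b -> 12 * b <= c -> t * c <= 16 * (t - 1) * b ->
  t ^+ 2 * c =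
    8 * (3 * t ^+ 2 - 3 * t + 1) * b - 128 * (t - 1) ^+ 2 * a ->
  (t + 1) ^+ 2 * d = 8 * (3 * t ^+ 2 + 3 * t + 1) * c - 128 * t ^+ 2 * b ->
  (b / a) * (d / c) <= (c / b) ^+ 2.
Proof.
move=> ht ha hb hcl hcu hc hd.
have hc0 : 0 < c by lra.
(* Product of the coefficients of [a] and [d] in the two recurrences, which lets both be
   eliminated. *)
have hk : 0 < 128 * (t - 1) ^+ 2 * (t + 1) ^+ 2.
  by rewrite !mulr_gt0 ?exprn_gt0 //; lra.
have key : b ^+ 3 * d <= a * c ^+ 3.
  rewrite -(ler_pM2l hk) -subr_ge0.
  have := quartic_ge0 ht hb hcl hcu; rewrite -hd hc.
  by congr (0 <= _); ring.
rewrite mulf_div expr_div_n ler_pdivrMr ?mulr_gt0 // mulrAC.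
rewrite ler_pdivlMr ?exprn_gt0 //.
by move: key; congr (_ <= _); ring.
Qed.

Section Sequence.
Variable P : nat -> R.
Hypothesis hP : Catalan_Larcombe_French P.

Lemma clf_recS k : (k.+1%:R + 1) ^+ 2 * P k.+2 =
  8 * (3 * k.+1%:R ^+ 2 + 3 * k.+1%:R + 1) * P k.+1
  - 128 * k.+1%:R ^+ 2 * P k.
Proof.
have [_ _ /(_ k.+2 isT)] := hP.
rewrite !subSS !subn0 -[k.+2%:R]natr1 => ->.
by ring.
Qed.

Lemma clf_values :
  [/\ P 2 = 80, P 3 = 896, P 4 = 104 ^+ 2 & P 5 = 269 * 512].
Proof.
have [h0 h1 _] := hP.
have := clf_recS 0; have := clf_recS 1; have := clf_recS 2.
have := clf_recS 3; rewrite h0 h1 => h5 h4 h3 h2.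
by split; lra.
Qed.

(** The first ratio covered is [P 5 / P 4]: at [n = 4] the upper bound is [12], but
    [P 4 / P 3 = 169 / 14]. *)
Lemma clf_bounds k : [/\ 0 < P k.+4, 12 * P k.+4 <= P k.+4.+1
  & k.+4.+1%:R * P k.+4.+1 <= 16 * (k.+4.+1%:R - 1) * P k.+4].
Proof.
elim: k => [|k [hb hl hu]].
  by have [_ _ -> ->] := clf_values; split; lra.
have hrec := clf_recS k.+4.
have ht : 5 <= k.+4.+1%:R :> R by rewrite ler_nat.
split; first lra.
  by apply: lower_bound_step hl hrec; lra.
rewrite -[k.+4.+2%:R]natr1 addrK.
by apply: upper_bound_step hu hrec; lra.
Qed.

Lemma clf_gt0 k : 0 < P k.
Proof.
have [h0 h1 _] := hP; have [h2 h3 _ _] := clf_values.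
case: k => [|[|[|[|k]]]]; rewrite ?h0 ?h1 ?h2 ?h3 //.
by have [] := clf_bounds k.
Qed.

End Sequence.
End RealField.

Theorem theorem1p2 (R : realFieldType) (P : nat -> R)
    (hP : Catalan_Larcombe_French P) : ratio_log_concave P.
Proof.
have [h0 h1 hrec] := hP; have [h2 h3 h4 h5] := clf_values hP.
case=> [|[|[|[|[|k]]]]] // _; rewrite addn1 !subSS !subn0.
- by rewrite h0 h1 h2 h3; lra.
- by rewrite h1 h2 h3 h4; lra.
- by rewrite h2 h3 h4 h5; lra.
have [hb hl hu] := clf_bounds hP k.
apply: (ratio_log_concave_of_bounds (t := k.+4.+1%:R)) hb hl hu _ _.
- by rewrite ler_nat.
- exact: clf_gt0.
- by have := hrec k.+4.+1 isT; rewrite !subSS !subn0.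
exact: clf_recS.
Qed.
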